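(* Let $E=\mathbb{Q}(\sqrt{-1})$ and $\mathfrak{O}=\mathbb{Z}[\sqrt{-1}]$. The ternary Hermitian $\mathfrak{O}$-lattice $\langle 1,1,1\rangle$ is $2$-universal.
   Context: A Hermitian $\mathfrak{O}$-lattice is a finitely generated $\mathfrak{O}$-submodule $L$ of a finite-dimensional $E$-vector space equipped with a form $H$ that is linear in the first variable, satisfies $H(x,y)=\overline{H(y,x)}$ (bar is complex conjugation), and has $H(L,L)\subseteq\mathfrak{O}$. Its rank is $\dim_E EL$; binary means rank 2, ternary means rank 3. It is positive (definite) if $H(v):=H(v,v)>0$ for all $0\neq v\in L$. Here every lattice is free ($\mathfrak{O}$ is a PID); the Gram matrix of a lattice with basis $v_1,\dots,v_n$ is $M_L=(H(v_i,v_j))$. $\langle a_1,\dots,a_n\rangle$ denotes the free lattice with diagonal Gram matrix with entries $a_1,\dots,a_n$. $L$ represents $\ell$ if $M_\ell=XM_LX^*$ for some matrix $X$ over $\mathfrak{O}$, where $X^*$ is the conjugate transpose. A positive Hermitian $\mathfrak{O}$-lattice is $2$-universal if it represents all binary positive Hermitian $\mathfrak{O}$-lattices. *)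

(* Defs.v *)
From HB Require Import structures.
From mathcomp Require Import all_boot all_order all_algebra.
From mathcomp Require Import complex.

Set Implicit Arguments.
Unset Strict Implicit.
Unset Printing Implicit Defensive.

Import Order.TTheory GRing.Theory Num.Theory.

Local Open Scope ring_scope.

(* The field E = Q(sqrt(-1)), as pairs x +i* y of rationals. *)
Notation E := (complex rat).

(* A copy of conjc: the library makes conjc a ring morphism only over a real
   closed field, and an instance on conjc itself would clash with that one. *)
Definition conjE (z : E) : E := conjc z.

Lemma conjE_is_zmod_morphism : zmod_morphism conjE.
Proof. by move=> [a b] [c d]; congr Complex; rewrite /= opprB opprK addrC. Qed.

Lemma conjE_is_monoid_morphism : monoid_morphism conjE.
Proof.
split=> [|[a b] [c d]]; first by congr Complex; rewrite oppr0.
by congr Complex; rewrite /= ?mulrNN // mulrN mulNr opprD.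
Qed.

HB.instance Definition _ :=
  GRing.isZmodMorphism.Build E E conjE conjE_is_zmod_morphism.
HB.instance Definition _ :=
  GRing.isMonoidMorphism.Build E E conjE conjE_is_monoid_morphism.

Lemma conjEK : involutive conjE.
Proof. by move=> [a b]; rewrite /conjE /= opprK. Qed.

(* The ring O = Z[sqrt(-1)] inside E. *)
Definition gaussInt : {pred E} :=
  [pred z | (complex.Re z \is a Num.int) && (complex.Im z \is a Num.int)].

Lemma gaussInt_subring : subring_closed gaussInt.
Proof.
split=> [|x y|x y]; first by [].
- case: x y => [a b] [c d]; rewrite !inE /= => /andP[ha hb] /andP[hc hd].
  by rewrite !rpredB.
- case: x y => [a b] [c d]; rewrite !inE /= => /andP[ha hb] /andP[hc hd].
  by rewrite rpredB ?rpredD ?rpredM.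
Qed.

HB.instance Definition _ := GRing.isSubringClosed.Build E gaussInt
  gaussInt_subring.

Lemma gaussInt_int (a : int) : a%:~R \in gaussInt.
Proof. exact: rpred_int. Qed.

Lemma conjE_int (a : int) : conjE a%:~R = a%:~R.
Proof. exact: rmorph_int. Qed.

Definition gaussSpan (V : lmodType E) (s : seq V) (v : V) : Prop :=
  exists c : 'I_(size s) -> E,
    (forall i, c i \in gaussInt) /\ v = \sum_(i < size s) c i *: s`_i.

(* The lattice is the O-submodule of hspace generated by the finite family
   hgens, which need not be O-independent. By the library's convention
   {hermitian_sym _ for conjE} is linear in the first variable. *)
Record hermLattice := HermLattice {
  hspace : vectType E;
  hform : {hermitian_sym hspace for conjE};
  hgens : seq hspace;
  hform_int : forall x y, gaussSpan hgens x -> gaussSpan hgens y ->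
    hform x y \in gaussInt
}.

Definition inLattice (L : hermLattice) (v : hspace L) : Prop :=
  gaussSpan (hgens L) v.

Definition lrank (L : hermLattice) : nat := \dim <<hgens L>>%VS.

Definition binary (L : hermLattice) : Prop := lrank L = 2.

(* hform L v v is fixed by conjE, so its imaginary part vanishes and
   positivity is a condition on its real part. *)
Definition lpositive (L : hermLattice) : Prop :=
  forall v : hspace L, inLattice v -> v != 0 ->
    0 < complex.Re (hform L v v).

Definition lbasis (L : hermLattice) (n : nat) (b : n.-tuple (hspace L)) : Prop :=
  free b /\ forall v, inLattice v <-> gaussSpan b v.

Definition gram (L : hermLattice) (n : nat) (b : n.-tuple (hspace L)) : 'M[E]_n :=
  \matrix_(i, j) hform L b`_i b`_j.

Definition conjT (m n : nat) (X : 'M[E]_(m, n)) : 'M[E]_(n, m) :=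
  (map_mx conjE X)^T.

Definition represents (L l : hermLattice) : Prop :=
  exists (m n : nat) (B : m.-tuple (hspace L)) (b : n.-tuple (hspace l)),
    lbasis B /\ lbasis b /\
    exists X : 'M[E]_(n, m),
      X \is a mxOver gaussInt /\ gram b = X *m gram B *m conjT X.

Definition two_universal (L : hermLattice) : Prop :=
  lpositive L /\ forall l, binary l -> lpositive l -> represents L l.

Section Diag.

Variables (n : nat) (a : n.-tuple int).

Definition diagForm (x y : 'rV[E]_n) : E :=
  \sum_(i < n) x 0 i * (tnth a i)%:~R * conjE (y 0 i).

Lemma diagForm_bilinear :
  bilinear_for *%R (conjE \; *%R : GRing.Scale.law E E) diagForm.
Proof.
split=> [y c x x'|x c y y'] /=; rewrite /diagForm mulr_sumr -big_split /=.
  by apply: eq_bigr => i _; rewrite !mxE !mulrDl !mulrA.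
apply: eq_bigr => i _; rewrite !mxE rmorphD rmorphM mulrDr.
by rewrite mulrCA.
Qed.

HB.instance Definition _ := bilinear_isBilinear.Build E 'rV[E]_n 'rV[E]_n E
  *%R (conjE \; *%R) diagForm diagForm_bilinear.

Lemma diagForm_herm (x y : 'rV[E]_n) :
  diagForm x y = (-1) ^+ false * conjE (diagForm y x).
Proof.
rewrite mul1r /diagForm rmorph_sum; apply: eq_bigr => i _.
rewrite !rmorphM /= conjEK conjE_int.
by rewrite mulrC [x 0 i * _]mulrC mulrA.
Qed.

HB.instance Definition _ := isHermitianSesquilinear.Build E 'rV[E]_n
  false conjE diagForm diagForm_herm.

Definition diagBasis : n.-tuple 'rV[E]_n :=
  [tuple delta_mx 0 i | i < n].

Lemma diagBasis_nth (i : 'I_n) : diagBasis`_i = delta_mx 0 i.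
Proof. by rewrite -tnth_nth tnth_mktuple. Qed.

Lemma diagBasis_span x :
  gaussSpan diagBasis x <-> forall i, x 0 i \in gaussInt.
Proof.
have sz : size diagBasis = n := size_tuple _.
split=> [[c [hc ->]] j|hx].
  rewrite summxE rpred_sum // => i _; rewrite mxE rpredM //.
  have hi : (i < n)%N by rewrite -[X in (_ < X)%N]sz.
  rewrite (diagBasis_nth (Ordinal hi)) mxE.
  by case: (_ && _); rewrite ?rpred1 ?rpred0.
exists (fun i => x 0 (cast_ord sz i)); split=> // .
rewrite [LHS]row_sum_delta (reindex (cast_ord sz)) /=; last first.
  exists (cast_ord (esym sz)) => i _; first exact: cast_ordK.
  exact: cast_ordKV.
by apply: eq_bigr => i _; rewrite -diagBasis_nth.
Qed.

Lemma diagForm_int x y : gaussSpan diagBasis x -> gaussSpan diagBasis y ->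
  diagForm x y \in gaussInt.
Proof.
move=> /diagBasis_span hx /diagBasis_span hy; apply: rpred_sum => i _.
rewrite !rpredM ?gaussInt_int //.
have := hy i; rewrite !inE; case: (y 0 i) => u v /= /andP[-> hv].
by rewrite rpredN.
Qed.

(* <a_1, ..., a_n>, realised on the standard basis of E^n. The diagonal
   entries of a Hermitian matrix over O are rational integers. *)
Definition diagLattice : hermLattice :=
  @HermLattice 'rV[E]_n diagForm diagBasis diagForm_int.

Lemma diagBasis_free : free diagBasis.
Proof.
apply/freeP => k h i.
have := congr1 (fun u : 'rV_n => u 0 i) h.
rewrite summxE mxE (bigD1 i) //= big1 => [|j ne_ji].
  by rewrite addr0 mxE diagBasis_nth mxE !eqxx mulr1.
by rewrite mxE diagBasis_nth mxE eqxx /= eq_sym (negPf ne_ji) mulr0.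
Qed.

Lemma diagLattice_basis : @lbasis diagLattice n diagBasis.
Proof. by split; first exact: diagBasis_free. Qed.

Lemma diagLattice_rank : lrank diagLattice = n.
Proof.
by rewrite /lrank /= (eqP (diagBasis_free : \dim _ == _)) size_tuple.
Qed.

Lemma diagLattice_gram :
  @gram diagLattice n diagBasis = diag_mx (\row_i (tnth a i)%:~R).
Proof.
apply/matrixP => i j; rewrite !mxE /= !diagBasis_nth /diagForm.
rewrite (bigD1 i) //= big1 => [|k ne_ki].
  rewrite addr0 !mxE !eqxx mul1r /=.
  by case: eqP => _ /=; rewrite ?rmorph1 ?rmorph0 ?mulr1 ?mulr0 ?mulr1n ?mulr0n.
by rewrite mxE (negPf ne_ki) andbF !mul0r.
Qed.

End Diag.

(* Main.v *)
From HB Require Import structures.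
Require Import Defs.
From mathcomp Require Import all_boot all_order all_algebra.
From mathcomp Require Import complex.
From mathcomp Require Import ring lra zify.
From Stdlib Require Import Classical.

Set Implicit Arguments.
Unset Strict Implicit.
Unset Printing Implicit Defensive.
Import Order.TTheory GRing.Theory Num.Theory.
Local Open Scope ring_scope.

(** A binary form with determinant [d] is put into the ternary form [G = ell _|_
    <d>], whose determinant [d ^ 2] is the norm of [d]. The proof rests on two
    facts about positive ternary Gram matrices over [Z[i]].

    If the determinant of a ternary lattice is a norm [N(delta)] greater than 1,
    the lattice is not maximal: it has a strictly larger integral overlattice
    whose determinant is again a norm ([improvable_of_norm_disc]). Take a
    Gaussian prime [q] dividing [delta]. The Gram matrix is singular mod [q], so
    some [v] outside [qL] satisfies [<v, L> = 0] mod [q]; if moreover [N(q)]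
    divides [<v, v>], then [L + O (v / q)] is integral with determinant [N(delta
    / q)]. A nonzero row of the adjugate matrix mod [q] is such a [v]. If the
    adjugate vanishes mod [q], a vector of the radical will do when [q] is not
    associated to a rational prime, since then [q | n] forces [N(q) | n] for
    integers [n]. When [q] is a rational prime [p], the radical mod [p] has rank
    at least two, and it contains an isotropic vector for the form divided by
    [p] because every residue mod [p] is a sum of two squares.

    If the determinant is 1, the lattice is <1,1,1> ([unimodular_realizable]).
    Among all bases choose one for which [n1 + minor] is minimal, where [n1] is
    the first diagonal entry and [minor] the leading 2 x 2 minor, and
    size-reduce it. The inequalities force [n1 <= 2]; [n1 = 1] gives the
    identity matrix, and [n1 = 2] makes every term of the determinant even.

    Descending along overlattices therefore ends in <1,1,1>, and undoing the
    inclusions writes [ell] as a Gram matrix of two vectors of [Z[i]^3].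
    Finally, an abstract binary lattice has a basis ([binary_basis]): take
    independent lattice vectors with least Gram determinant; a vector with a
    non-integral coordinate would, after rounding, give a smaller
    determinant. *)

(** * The ring of Gaussian integers *)

(** Pairs of integers rather than a subtype of the field of Gaussian numbers:
    polynomial identities then reduce to [ring] over [int], and sizes are
    integers, on which [lia] and [nia] work. *)
Record gauss := Gauss { re : int; im : int }.

Lemma gauss_eq z w : re z = re w -> im z = im w -> z = w.
Proof. by case: z w => [a b] [c d] /= -> ->. Qed.

Definition pair_of_gauss z := (re z, im z).
Definition gauss_of_pair (p : int * int) := Gauss p.1 p.2.
Lemma pair_of_gaussK : cancel pair_of_gauss gauss_of_pair.
Proof. by case. Qed.
HB.instance Definition _ := Choice.copy gauss (can_type pair_of_gaussK).

Definition addg z w := Gauss (re z + re w) (im z + im w).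
Definition oppg z := Gauss (- re z) (- im z).
Definition mulg z w :=
  Gauss (re z * re w - im z * im w) (re z * im w + im z * re w).

Lemma addgA : associative addg.
Proof. by move=> x y z; apply: gauss_eq => /=; ring. Qed.
Lemma addgC : commutative addg.
Proof. by move=> x y; apply: gauss_eq => /=; ring. Qed.
Lemma add0g : left_id (Gauss 0 0) addg.
Proof. by move=> x; apply: gauss_eq => /=; ring. Qed.
Lemma addNg : left_inverse (Gauss 0 0) oppg addg.
Proof. by move=> x; apply: gauss_eq => /=; ring. Qed.
HB.instance Definition _ :=
  GRing.isZmodule.Build gauss addgA addgC add0g addNg.

Lemma mulgA : associative mulg.
Proof. by move=> x y z; apply: gauss_eq => /=; ring. Qed.
Lemma mulgC : commutative mulg.
Proof. by move=> x y; apply: gauss_eq => /=; ring. Qed.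
Lemma mul1g : left_id (Gauss 1 0) mulg.
Proof. by move=> x; apply: gauss_eq => /=; ring. Qed.
Lemma mulgDl : left_distributive mulg +%R.
Proof. by move=> x y z; apply: gauss_eq => /=; ring. Qed.
Lemma oneg_neq0 : Gauss 1 0 != 0.
Proof. by []. Qed.
HB.instance Definition _ := GRing.Zmodule_isComNzRing.Build gauss
  mulgA mulgC mul1g mulgDl oneg_neq0.

Definition conjg z := Gauss (re z) (- im z).
Lemma conjg_is_zmod_morphism : zmod_morphism conjg.
Proof. by move=> x y; apply: gauss_eq => /=; ring. Qed.
Lemma conjg_is_monoid_morphism : monoid_morphism conjg.
Proof. by split=> [|x y]; apply: gauss_eq => //=; ring. Qed.
HB.instance Definition _ :=
  GRing.isZmodMorphism.Build gauss gauss conjg conjg_is_zmod_morphism.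
HB.instance Definition _ :=
  GRing.isMonoidMorphism.Build gauss gauss conjg conjg_is_monoid_morphism.

Lemma intrG n : n%:~R = Gauss n 0.
Proof.
have natG (m : nat) : m%:R = Gauss m 0.
  by elim: m => [|m IH] //; rewrite mulrS IH; apply: gauss_eq => //=; lia.
case: n => m; first exact: natG.
by rewrite NegzE mulrNz -[_%:~R]/(m.+1%:R) natG.
Qed.

Lemma int_inj (m n : int) : m%:~R = n%:~R :> gauss -> m = n.
Proof. by rewrite !intrG => -[]. Qed.

Definition normg z : int := re z ^+ 2 + im z ^+ 2.

Lemma reD z w : re (z + w) = re z + re w. Proof. by []. Qed.
Lemma imD z w : im (z + w) = im z + im w. Proof. by []. Qed.
Lemma reN z : re (- z) = - re z. Proof. by []. Qed.
Lemma imN z : im (- z) = - im z. Proof. by []. Qed.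
Lemma reM z w : re (z * w) = re z * re w - im z * im w. Proof. by []. Qed.
Lemma imM z w : im (z * w) = re z * im w + im z * re w. Proof. by []. Qed.
Lemma re_conj z : re (conjg z) = re z. Proof. by []. Qed.
Lemma im_conj z : im (conjg z) = - im z. Proof. by []. Qed.
Lemma re_int n : re n%:~R = n. Proof. by rewrite intrG. Qed.
Lemma im_int n : im n%:~R = 0. Proof. by rewrite intrG. Qed.
Lemma re0 : re 0 = 0. Proof. by []. Qed.
Lemma im0 : im 0 = 0. Proof. by []. Qed.
Lemma re1 : re 1 = 1. Proof. by []. Qed.
Lemma im1 : im 1 = 0. Proof. by []. Qed.

Definition gaussE := (re0, im0, re1, im1, reD, imD, reN, imN, reM, imM,
  re_conj, im_conj, re_int, im_int).

Ltac gauss_ring :=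
  rewrite /normg; try apply: gauss_eq; rewrite ?gaussE; ring.

Lemma conjgK : involutive conjg.
Proof. by move=> z; gauss_ring. Qed.

Lemma mul_conjg z : z * conjg z = (normg z)%:~R.
Proof. by gauss_ring. Qed.
Lemma add_conjg z : z + conjg z = (2 * re z)%:~R.
Proof. by gauss_ring. Qed.
Lemma normgM z w : normg (z * w) = normg z * normg w.
Proof. by gauss_ring. Qed.

(** * Divisibility and Gaussian primes *)

Lemma normg_ge0 z : 0 <= normg z.
Proof. by rewrite addr_ge0 ?sqr_ge0. Qed.

Lemma normg_eq0 z : (normg z == 0) = (z == 0).
Proof.
apply/eqP/eqP => [|->]; last by gauss_ring.
rewrite /normg => nz0; apply: gauss_eq; rewrite gaussE; nia.
Qed.

Lemma normg_gt0 z : z != 0 -> 0 < normg z.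
Proof. by rewrite lt_def normg_ge0 normg_eq0 andbT. Qed.

Lemma normg_conj z : normg (conjg z) = normg z.
Proof. by gauss_ring. Qed.
Lemma normg_int (n : int) : normg n%:~R = n ^+ 2.
Proof. by gauss_ring. Qed.

Lemma round_int (m n : int) : 0 < n -> exists k : int, `|2 * (m - k * n)| <= n.
Proof.
move=> n_gt0; have := divz_eq m n; have := ltz_pmod m n_gt0.
have := modz_ge0 m (lt0r_neq0 n_gt0).
set r := (m %% n)%Z; set k := (m %/ n)%Z => r_ge0 r_lt ->.
have [le_r|lt_r] := lerP (2 * r) n.
  by exists k; rewrite addrC addKr; lia.
by exists (k + 1); rewrite mulrDl mul1r; lia.
Qed.

Lemma round_gauss (z : gauss) (n : int) :
  0 < n -> exists k, 2 * normg (z - k * n%:~R) <= n ^+ 2.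
Proof.
move=> n_gt0; have [k k_le] := @round_int (re z) _ n_gt0.
have [l l_le] := @round_int (im z) _ n_gt0.
exists (Gauss k l); rewrite /normg !gaussE !mulr0 subr0 add0r /=.
move: k_le l_le; set u := re z - _; set v := im z - _ => u_le v_le; nia.
Qed.

(** Multiplying by [conjg q] turns division by [q] into division by the integer
    [normg q], where both coordinates can be rounded separately. *)
Lemma euclid (z q : gauss) :
  q != 0 -> exists k, 2 * normg (z - k * q) <= normg q.
Proof.
move=> q_neq0; have n_gt0 := normg_gt0 q_neq0.
have [k k_le] := @round_gauss (z * conjg q) _ n_gt0; exists k.
have: normg (z * conjg q - k * (normg q)%:~R) = normg (z - k * q) * normg q.
  by rewrite -mul_conjg -[X in _ = _ * X]normg_conj -normgM; congr normg; ring.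
by move=> eq_n; rewrite eq_n mulrA expr2 ler_pM2r in k_le.
Qed.

Definition dvdg (q z : gauss) := exists t, z = q * t.

Lemma dvdg_refl q : dvdg q q. Proof. by exists 1; rewrite mulr1. Qed.
Lemma dvdg0 q : dvdg q 0. Proof. by exists 0; rewrite mulr0. Qed.
Lemma dvdg_mulr q z w : dvdg q z -> dvdg q (z * w).
Proof. by case=> t ->; exists (t * w); rewrite mulrA. Qed.
Lemma dvdg_mull q z w : dvdg q z -> dvdg q (w * z).
Proof. by rewrite mulrC; apply: dvdg_mulr. Qed.
Lemma dvdgD q z w : dvdg q z -> dvdg q w -> dvdg q (z + w).
Proof. by case=> s -> [t ->]; exists (s + t); rewrite mulrDr. Qed.
Lemma dvdgN q z : dvdg q z -> dvdg q (- z).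
Proof. by case=> s ->; exists (- s); rewrite mulrN. Qed.
Lemma dvdgB q z w : dvdg q z -> dvdg q w -> dvdg q (z - w).
Proof. by move=> dz /dvdgN; apply: dvdgD. Qed.
Lemma dvdg_trans r q z : dvdg q r -> dvdg r z -> dvdg q z.
Proof. by move=> dqr [t ->]; apply: dvdg_mulr. Qed.

Lemma dvdg_leq q z : z != 0 -> dvdg q z -> normg q <= normg z.
Proof.
move=> z_neq0 [t def_z]; rewrite def_z normgM ler_peMr ?normg_ge0 //.
by apply: normg_gt0; apply: contraNneq z_neq0 => t0; rewrite def_z t0 mulr0.
Qed.

Lemma bezout (z q : gauss) :
  exists g u v, [/\ g = u * z + v * q, dvdg g z & dvdg g q].
Proof.
elim: {q}_.+1 {-2}q z (ltnSn `|normg q|%N) => // n IH q z le_q.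
have [->|q_neq0] := eqVneq q 0.
  exists z, 1, 0; split; [by ring | exact: dvdg_refl | exact: dvdg0].
have [k k_le] := @euclid z q q_neq0; have q_gt0 := normg_gt0 q_neq0.
have lt_r : (`|normg (z - k * q)%R| < n)%N.
  by have := normg_ge0 (z - k * q); lia.
have [g [u [v [def_g g_q g_r]]]] := IH _ q lt_r.
exists g, v, (u - v * k); split=> //; first by rewrite def_g; ring.
suff: dvdg g (z - k * q + k * q) by rewrite subrK.
by apply: dvdgD => //; apply: dvdg_mull.
Qed.

(** A divisor of [delta] of least norm among the non-units is a Gaussian prime;
    this form of primality yields both the inverses mod [q] and the dichotomy of
    [least_divisor_cases] without any factorization theory. *)
Definition least_divisor (delta q : gauss) :=
  [/\ dvdg q delta, 1 < normg q &
   forall r, dvdg r delta -> 1 < normg r -> normg q <= normg r].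

Lemma least_divisor_exists delta :
  1 < normg delta -> exists q, least_divisor delta q.
Proof.
move: {1 3}delta (dvdg_refl delta) => r.
elim: {r}_.+1 {-2}r (ltnSn `|normg r|%N) => // n IH r le_r r_delta r_gt1.
have [|no_less] := classic
  (exists s, [/\ dvdg s delta, 1 < normg s & normg s < normg r]).
  by case=> s [s_delta s_gt1 lt_s]; apply: (IH s) => //; lia.
exists r; split=> // s s_delta s_gt1; rewrite leNgt; apply/negP => lt_s.
by apply: no_less; exists s.
Qed.

Lemma gauss_unit z : normg z = 1 -> z * conjg z = 1.
Proof. by rewrite mul_conjg => ->. Qed.

Section LeastDivisor.
Variables delta q : gauss.
Hypothesis q_least : least_divisor delta q.

Lemma least_gt1 : 1 < normg q. Proof. by case: q_least. Qed.

(** A gcd of [z] and [q] is a divisor of [delta], hence a unit or as large as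
    [q]; in the latter case it is associated to [q], which would divide [z]. *)
Lemma least_divisor_inv z : ~ dvdg q z -> exists u t, u * z = 1 + q * t.
Proof.
have [q_delta q_gt1 q_min] := q_least => q_z.
have [g [u [v [def_g g_z g_q]]]] := bezout z q.
have [h def_q] := g_q.
have qE : normg q = normg g * normg h by rewrite def_q normgM.
have := normg_ge0 g; have := normg_ge0 h => h_ge0 g_ge0.
have [g_gt1|g_le1] := ltP 1 (normg g).
  have := q_min g (dvdg_trans g_q q_delta) g_gt1 => le_qg.
  have h1 : normg h = 1 by nia.
  case: q_z; apply: dvdg_trans g_z.
  by exists (conjg h); rewrite def_q -mulrA gauss_unit ?mulr1.
have g1 : normg g = 1 by nia.
exists (conjg g * u), (- (conjg g * v)).
have uzE : u * z = g - v * q by rewrite def_g; ring.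
by rewrite -(gauss_unit g1) -mulrA uzE; ring.
Qed.

Lemma least_divisor_prime z w : dvdg q (z * w) -> dvdg q z \/ dvdg q w.
Proof.
have [|q_z] := classic (dvdg q z); [by left | right].
have [u [t uzE]] := least_divisor_inv q_z.
have -> : w = u * (z * w) - q * (t * w) by rewrite mulrA uzE; ring.
apply: dvdgB; first exact: dvdg_mull.
exact: dvdg_mulr (dvdg_refl q).
Qed.

End LeastDivisor.

Lemma dvdg_int (m n : int) : (m %| n)%Z -> dvdg m%:~R n%:~R.
Proof. by case/dvdzP=> k ->; exists k%:~R; rewrite -rmorphM mulrC. Qed.

Lemma dvdg_intP (m : int) z :
  dvdg m%:~R z <-> ((m %| re z)%Z /\ (m %| im z)%Z).
Proof.
split=> [[t ->]|[/dvdzP[k re_k] /dvdzP[l im_l]]].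
  by rewrite !gaussE !mul0r subr0 addr0; split; apply: dvdz_mulr.
by exists (Gauss k l); apply: gauss_eq; rewrite !gaussE ?re_k ?im_l /=; ring.
Qed.

(** From [n = q t] one gets [n * conjg q = normg q * t], so that [normg q]
    divides [n * re q] and [n * im q]. *)
Lemma dvd_norm_int q (n : int) :
  coprimez (re q) (im q) -> dvdg q n%:~R -> (normg q %| n)%Z.
Proof.
move=> cop [t def_n].
have eq_nq : n%:~R * conjg q = (normg q)%:~R * t.
  by rewrite def_n -mul_conjg; ring.
have /dvdg_intP[] : dvdg (normg q)%:~R (n%:~R * conjg q) by exists t.
rewrite !gaussE !mul0r subr0 addr0 mulrN rpredN => dvd_re dvd_im.
have : (normg q %| gcdz (n * re q) (n * im q))%Z by rewrite dvdz_gcd dvd_re.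
by rewrite -mulz_gcdr (eqP cop) mulr1.
Qed.

(** If the coordinates of [q] share a prime factor [p], then [p] divides [q] and
    is thus itself a divisor of [delta] of least norm. *)
Lemma least_divisor_cases delta q : least_divisor delta q ->
  coprimez (re q) (im q) \/
  exists p : nat, prime p /\ least_divisor delta p%:R.
Proof.
move=> [q_delta q_gt1 q_min].
have [|ncop] := boolP (coprimez (re q) (im q)); [by left | right].
have g_gt1 : (1 < gcdn `|re q| `|im q|)%N.
  have : gcdn `|re q| `|im q| != 0%N.
    rewrite -lt0n gcdn_gt0; move: q_gt1; rewrite /normg; nia.
  by move: ncop; rewrite /coprimez /gcdz; case: gcdn => [|[|]].
exists (pdiv (gcdn `|re q| `|im q|)); split; first exact: pdiv_prime.
set p := pdiv _; have p_gt1 : (1 < p)%N by apply/prime_gt1/pdiv_prime.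
have p_q : dvdg p%:R q.
  apply/(dvdg_intP p); rewrite !dvdzE /= /p.
  by split; apply: dvdn_trans (pdiv_dvd _) _; rewrite ?dvdn_gcdl ?dvdn_gcdr.
have p_norm : normg p%:R = (p%:Z) ^+ 2 by exact: (normg_int p).
split; [exact: dvdg_trans q_delta | by rewrite p_norm; nia | ].
move=> r r_delta r_gt1; apply: le_trans (q_min r r_delta r_gt1).
by apply: dvdg_leq => //; rewrite -normg_eq0 gt_eqF // (lt_trans _ q_gt1).
Qed.

(** * Isotropic vectors modulo a rational prime *)

(** The squares of [0, ..., p/2] are distinct mod [p], and so are the values
    [- m - j ^ 2] for [j] in the same range; together these are more than [p]
    residues, hence some [i ^ 2] equals some [- m - j ^ 2]. *)
Lemma sum_two_squares_mod (p : nat) (m : int) :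
  prime p -> exists g, (p %| normg g + m)%Z.
Proof.
move=> p_pr; pose k := p./2.+1.
pose sq (i : 'I_k) : 'F_p := (i%:R) ^+ 2.
have p_dvd (n : int) : (p %| n)%Z = (n%:~R == 0 :> 'F_p).
  exact: (dvdz_pcharf (pchar_Fp p_pr)).
have sq_inj : injective sq.
  move=> i j /eqP; rewrite -subr_eq0 subr_sqr.
  wlog lt_ji : i j / (j < i)%N => [wl|].
    have [lt_ij|lt_ji|/val_inj//] := ltngtP i j; last exact: wl.
    rewrite -subr_sqr => eq0; apply/esym/(wl _ _ lt_ij).
    by rewrite -subr_sqr -opprB oppr_eq0.
  have -> : (i%:R - j%:R) * (i%:R + j%:R) =
      (((i - j) * (i + j))%:Z)%:~R :> 'F_p.
    by rewrite PoszM intrM -!pmulrn natrB ?natrD // ltnW.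
  have i_le : (i <= p./2)%N := ltn_ord i.
  have p_ge : (p./2.*2 <= p)%N by rewrite -[leqRHS]odd_double_half leq_addl.
  have p_gt1 := prime_gt1 p_pr.
  rewrite -p_dvd dvdzE /= Euclid_dvdM // => /orP[] /dvdn_leq le_p; exfalso.
    by have := le_p ltac:(lia); lia.
  by have := le_p ltac:(lia); lia.
pose opp_sq (i : 'I_k) : 'F_p := - m%:~R - sq i.
have opp_inj : injective opp_sq by move=> i j /addrI/oppr_inj/sq_inj.
have [x] : exists x, (x \in codom sq) && (x \in codom opp_sq).
  apply/existsP; apply: contraT => /existsPn dis.
  have := cardUI (mem (codom sq)) (mem (codom opp_sq)).
  have -> : #|[predI mem (codom sq) & mem (codom opp_sq)]| = 0%N.
    by apply: eq_card0 => y; apply/negbTE/dis.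
  have := max_card [predU mem (codom sq) & mem (codom opp_sq)].
  rewrite addn0 => + eq_c; rewrite eq_c.
  rewrite !card_codom // card_ord card_Fp // /k.
  have := odd_double_half p; lia.
case/andP=> /codomP[i ->] /codomP[j /eqP]; rewrite -subr_eq0 /opp_sq /sq => eq0.
exists (Gauss (i : nat) (j : nat)); rewrite p_dvd /normg /=.
move: eq0; rewrite !rmorphD /= !rmorphXn /= -!pmulrn opprD !opprK.
by rewrite addrCA addrC.
Qed.

(** Completing the square, [a] times the form at [(s, 1)] is [normg (a * s +
    conjg x) + (a * c - normg x)]. When [a] is invertible mod [p], [a * s +
    conjg x] can be given any residue, in particular one whose norm is minus
    the determinant. *)
Lemma hermitian_isotropic_mod (p : nat) (a c : int) (x : gauss) : prime p ->
  exists s t, ~ (dvdg p%:R s /\ dvdg p%:R t) /\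
    (p %| a * normg s + 2 * re (s * conjg t * x) + c * normg t)%Z.
Proof.
move=> p_pr; have not_p1 : ~ dvdg p%:R 1.
  move/(dvdg_intP p) => [+ _]; rewrite gaussE dvdz1 /=.
  by apply/negP; rewrite gtn_eqF ?prime_gt1.
have [p_a|not_p_a] := boolP (p %| a)%Z.
  exists 1, 0; split; first by case=> /not_p1.
  rewrite (_ : _ + _ = a) //; gauss_ring.
have [g g_p] := sum_two_squares_mod (a * c - normg x) p_pr.
have cop : coprimez p a.
  by rewrite /coprimez /gcdz eqz_nat -/(coprime _ _) prime_coprime.
have [[u v] /= uv1] := coprimezP _ _ cop.
(* [v] inverts [a] mod [p], so this [s] makes [a * s + conjg x] congruent to
   [g]. *)
exists (v%:~R * (g - conjg x)), 1; split; first by case=> _ /not_p1.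
rewrite -(Gauss_dvdzr _ cop); set k := u * _ in uv1.
have va : v * a = 1 - u * p by lia.
have -> : a * (a * normg (v%:~R * (g - conjg x)) +
    2 * re (v%:~R * (g - conjg x) * conjg 1 * x) + c * normg 1)
  = normg ((v * a)%:~R * (g - conjg x) + conjg x) + (a * c - normg x).
  by gauss_ring.
rewrite va.
have -> : normg ((1 - u * p)%:~R * (g - conjg x) + conjg x)
      + (a * c - normg x)
  = normg g + (a * c - normg x) + p%:Z *
      (u * (u * p * normg (g - conjg x) - 2 * re (conjg g * (g - conjg x)))).
  by gauss_ring.
by rewrite rpredD // dvdz_mulr.
Qed.

(** * Ternary Gram matrices *)

Definition ip (u v : 'rV[gauss]_3) : gauss := \sum_i u 0 i * conjg (v 0 i).

Lemma ipDl u v w : ip (u + v) w = ip u w + ip v w.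
Proof. by rewrite -big_split; apply: eq_bigr => i _; rewrite mxE mulrDl. Qed.
Lemma ipZl k u w : ip (k *: u) w = k * ip u w.
Proof. by rewrite mulr_sumr; apply: eq_bigr => i _; rewrite mxE mulrA. Qed.
Lemma ip_conj u v : conjg (ip u v) = ip v u.
Proof.
rewrite rmorph_sum; apply: eq_bigr => i _ /=.
by rewrite rmorphM /= conjgK mulrC.
Qed.
Lemma ipDr u v w : ip w (u + v) = ip w u + ip w v.
Proof. by rewrite -!(ip_conj _ w) ipDl rmorphD. Qed.
Lemma ipZr k u w : ip w (k *: u) = conjg k * ip w u.
Proof. by rewrite -!(ip_conj _ w) ipZl rmorphM. Qed.

Definition ipE := (ipDl, ipZl, ipDr, ipZr).

(** The Hermitian matrix with diagonal [n1, n2, n3] and entries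
    [h12, h13, h23] above it; integers on the diagonal make it Hermitian by
    construction. *)
Record gram3 := Gram3 { n1 : int; n2 : int; n3 : int;
                        h12 : gauss; h13 : gauss; h23 : gauss }.

Definition minor G := n1 G * n2 G - normg (h12 G).
Definition disc G :=
  n1 G * n2 G * n3 G + 2 * re (h12 G * h23 G * conjg (h13 G))
  - n1 G * normg (h23 G) - n2 G * normg (h13 G) - n3 G * normg (h12 G).
Lemma discE a b c x y z : disc (Gram3 a b c x y z) =
  a * b * c + 2 * re (x * z * conjg y)
  - a * normg z - b * normg y - c * normg x.
Proof. by []. Qed.

(** Sylvester's criterion: the integers [n1] and [minor] are the quantities that
    the reduction below decreases, so their positivity is what is needed. *)
Definition posdef G := [/\ 0 < n1 G, 0 < minor G & 0 < disc G].

Definition gram_of G (u v w : 'rV[gauss]_3) :=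
  [/\ ip u u = (n1 G)%:~R, ip v v = (n2 G)%:~R & ip w w = (n3 G)%:~R] /\
  [/\ ip u v = h12 G, ip u w = h13 G & ip v w = h23 G].
Definition realizable G := exists u v w, gram_of G u v w.

Definition swap12 G :=
  Gram3 (n2 G) (n1 G) (n3 G) (conjg (h12 G)) (h23 G) (h13 G).
Definition swap23 G :=
  Gram3 (n1 G) (n3 G) (n2 G) (h13 G) (h12 G) (conjg (h23 G)).

Lemma realizable_swap12 G : realizable (swap12 G) -> realizable G.
Proof.
case=> u [v [w [[/= uu vv ww] [uv uw vw]]]]; exists v, u, w; split; split=> //.
by rewrite -ip_conj uv conjgK.
Qed.
Lemma realizable_swap23 G : realizable (swap23 G) -> realizable G.
Proof.
case=> u [v [w [[/= uu vv ww] [uv uw vw]]]]; exists u, w, v; split; split=> //.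
by rewrite -ip_conj vw conjgK.
Qed.

Lemma disc_swap12 G : disc (swap12 G) = disc G.
Proof. by case: G => a b c x y z; rewrite /disc /=; gauss_ring. Qed.
Lemma disc_swap23 G : disc (swap23 G) = disc G.
Proof. by case: G => a b c x y z; rewrite /disc /=; gauss_ring. Qed.

(** [n1 G] times the product of the projections of the second and third basis
    vectors orthogonally to the first. *)
Definition cominor G := (n1 G)%:~R * h23 G - conjg (h12 G) * h13 G.

(** Sylvester's determinant identity for the two 2 x 2 minors containing the
    first basis vector. *)
Lemma minor_swap23 G :
  minor G * minor (swap23 G) = normg (cominor G) + n1 G * disc G.
Proof.
by case: G => a b c x y z; rewrite /minor /cominor /disc /=; gauss_ring.
Qed.

Lemma posdef_swap12 G : posdef G -> posdef (swap12 G).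
Proof.
case=> n1_gt0 m_gt0 d_gt0; split; rewrite ?disc_swap12 //=.
  by have := normg_ge0 (h12 G); move: m_gt0; rewrite /minor; nia.
by move: m_gt0; rewrite /minor /= normg_conj mulrC.
Qed.
Lemma posdef_swap23 G : posdef G -> posdef (swap23 G).
Proof.
case=> n1_gt0 m_gt0 d_gt0; split; rewrite ?disc_swap23 //=.
have := minor_swap23 G; have := normg_ge0 (cominor G).
by have := mulr_gt0 n1_gt0 d_gt0; nia.
Qed.

(** The witness is the Gram matrix of a proper integral overlattice. The new
    determinant has to be a norm again for the descent to continue. *)
Definition improvable G := exists G' delta,
  [/\ posdef G', disc G' = normg delta, disc G' < disc G &
      realizable G' -> realizable G].

Lemma improvable_swap12 G : improvable (swap12 G) -> improvable G.
Proof.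
case=> G' [d [pG' dG' lt_d rG']]; exists G', d; split=> //.
  by rewrite -(disc_swap12 G).
by move/rG'/realizable_swap12.
Qed.
Lemma improvable_swap23 G : improvable (swap23 G) -> improvable G.
Proof.
case=> G' [d [pG' dG' lt_d rG']]; exists G', d; split=> //.
  by rewrite -(disc_swap23 G).
by move/rG'/realizable_swap23.
Qed.

(** [dot1], [dot2] and [dot3] are the products of the vector with coordinates
    [(a, b, c)] with the three basis vectors; [value] is its product with
    itself, a real number. *)
Definition dot1 G a b c :=
  a * (n1 G)%:~R + b * conjg (h12 G) + c * conjg (h13 G).
Definition dot2 G a b c :=
  a * h12 G + b * (n2 G)%:~R + c * conjg (h23 G).
Definition dot3 G a b c :=
  a * h13 G + b * h23 G + c * (n3 G)%:~R.
Definition value G a b c : int :=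
  re (dot1 G a b c * conjg a + dot2 G a b c * conjg b + dot3 G a b c * conjg c).

Lemma valueE G a b c : (value G a b c)%:~R =
  dot1 G a b c * conjg a + dot2 G a b c * conjg b + dot3 G a b c * conjg c.
Proof. by rewrite /value /dot1 /dot2 /dot3; gauss_ring. Qed.

Lemma dot_sym G a b c a' b' c' :
  dot1 G a' b' c' * conjg a + dot2 G a' b' c' * conjg b
  + dot3 G a' b' c' * conjg c
  = conjg (dot1 G a b c * conjg a' + dot2 G a b c * conjg b'
           + dot3 G a b c * conjg c').
Proof.
by rewrite /dot1 /dot2 /dot3 !(rmorphD, rmorphM) /= !conjgK; ring.
Qed.

Lemma value_pair G s t a b c a' b' c' :
  value G (s * a + t * a') (s * b + t * b') (s * c + t * c') =
  normg s * value G a b c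
  + 2 * re (s * conjg t * (dot1 G a b c * conjg a' +
              dot2 G a b c * conjg b' + dot3 G a b c * conjg c'))
  + normg t * value G a' b' c'.
Proof.
apply: int_inj; rewrite valueE [RHS]intrD [X in _ = X + _]intrD -add_conjg.
rewrite !(intrM, valueE) -!mul_conjg.
rewrite !rmorphM /= conjgK -dot_sym.
by rewrite /dot1 /dot2 /dot3; ring.
Qed.

(** * Overlattices *)

(** The overlattice has the basis [e1, e2, v / q], where [v = a e1 + b e2 + e3].
    The last coordinate of [v] being 1 makes [e1, e2, v] a basis of the original
    lattice, so the transition matrix is triangular. *)
Lemma improvable_last G delta q a b :
  posdef G -> disc G = normg delta -> dvdg q delta -> 1 < normg q ->
  dvdg q (dot1 G a b 1) -> dvdg q (dot2 G a b 1) ->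
  (normg q %| value G a b 1)%Z -> improvable G.
Proof.
move=> [n1_gt0 m_gt0 d_gt0] dG [delta' def_delta] q_gt1 [t1 def_t1] [t2 def_t2].
case/dvdzP=> n def_n.
pose G' := Gram3 (n1 G) (n2 G) n (h12 G) (conjg t1) (conjg t2).
have q_gt0 : 0 < normg q by apply: lt_trans q_gt1.
have dG' : disc G = normg q * disc G'.
  transitivity (disc (Gram3 (n1 G) (n2 G) (value G a b 1) (h12 G)
    (conjg (dot1 G a b 1)) (conjg (dot2 G a b 1)))).
    case: (G) => a' b' c' x y z.
    by rewrite /disc /value /dot1 /dot2 /dot3 /=; gauss_ring.
  by rewrite /G' !discE def_t1 def_t2 def_n; gauss_ring.
have d'_gt0 : 0 < disc G' by rewrite dG' pmulr_rgt0 in d_gt0.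
exists G', delta'; split=> //.
- apply: (mulfI (lt0r_neq0 q_gt0)).
  by rewrite -dG' dG def_delta normgM.
- by rewrite dG' ltr_pMl.
case=> u [v [w [[/= uu vv ww] [uv uw vw]]]].
have vu : ip v u = conjg (h12 G) by rewrite -ip_conj uv.
have wu : ip w u = t1 by rewrite -ip_conj uw conjgK.
have wv : ip w v = t2 by rewrite -ip_conj vw conjgK.
exists u, v, (q *: w + (- a) *: u + (- b) *: v); split; split=> //.
- rewrite !ipE uu vv ww uv uw vw vu wu wv.
  have -> : (n3 G)%:~R = (value G a b 1)%:~R - conjg a * dot1 G a b 1
      - a * conjg (dot1 G a b 1) - conjg b * dot2 G a b 1
      - b * conjg (dot2 G a b 1) + a * conjg a * (n1 G)%:~R
      + b * conjg b * (n2 G)%:~R + a * conjg b * h12 G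
      + conjg a * b * conjg (h12 G).
    by rewrite valueE /dot1 /dot2 /dot3 !(rmorphD, rmorphM) /= !conjgK; ring.
  by rewrite def_t1 def_t2 def_n rmorphM /= -mul_conjg; ring.
- rewrite !ipE uu uv uw.
  have -> : h13 G =
      conjg (dot1 G a b 1) - conjg a * (n1 G)%:~R - conjg b * h12 G.
    by rewrite /dot1; gauss_ring.
  by rewrite def_t1; ring.
- rewrite !ipE vu vv vw.
  have -> : h23 G = conjg (dot2 G a b 1)
      - conjg a * conjg (h12 G) - conjg b * (n2 G)%:~R.
    by rewrite /dot2; gauss_ring.
  by rewrite def_t2; ring.
Qed.

Section Improve.
Variables delta q : gauss.
Hypothesis q_least : least_divisor delta q.

Definition radical G a b c :=
  [/\ dvdg q (dot1 G a b c), dvdg q (dot2 G a b c) & dvdg q (dot3 G a b c)].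

(** Scaling by an inverse of [c] mod [q] and subtracting a multiple of [q e3]
    makes the last coordinate 1; the latter changes the value of the form by
    multiples of [normg q], as [v] is in the radical. *)
Lemma improvable_unit G a b c : posdef G -> disc G = normg delta ->
  radical G a b c -> (normg q %| value G a b c)%Z -> ~ dvdg q c ->
  improvable G.
Proof.
move=> pG dG [q1 q2 [s def_s]] q_v q_c.
have [u [t uc]] := least_divisor_inv q_least q_c.
have q_q := dvdg_refl q.
have [q_delta q_gt1 _] := q_least.
apply: (improvable_last (a := u * a) (b := u * b) pG dG q_delta q_gt1).
- have -> : dot1 G (u * a) (u * b) 1 =
      u * dot1 G a b c - q * (t * conjg (h13 G)).
    by rewrite /dot1 -[1](addrK (q * t)) -uc; ring.
  by apply: dvdgB; [apply: dvdg_mull | apply: dvdg_mulr].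
- have -> : dot2 G (u * a) (u * b) 1 =
      u * dot2 G a b c - q * (t * conjg (h23 G)).
    by rewrite /dot2 -[1](addrK (q * t)) -uc; ring.
  by apply: dvdgB; [apply: dvdg_mull | apply: dvdg_mulr].
have -> : value G (u * a) (u * b) 1 = normg u * value G a b c
    - 2 * re (u * conjg (q * t) * dot3 G a b c) + normg q * (normg t * n3 G).
  have c1 : u * c + - (q * t) * 1 = 1 by rewrite uc; ring.
  have := value_pair G u (- (q * t)) a b c 0 0 1.
  have c0 e : u * e + - (q * t) * 0 = u * e by ring.
  rewrite c1 !c0 => ->.
  have -> : dot1 G a b c * conjg 0 + dot2 G a b c * conjg 0
      + dot3 G a b c * conjg 1 = dot3 G a b c by ring.
  have -> : value G 0 0 1 = n3 G.
    by apply: int_inj; rewrite valueE /dot1 /dot2 /dot3; ring.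
  by move: (dot3 G a b c) (value G a b c) => d w; gauss_ring.
rewrite def_s.
have -> : u * conjg (q * t) * (q * s) = (normg q)%:~R * (u * conjg t * s).
  by rewrite -mul_conjg; ring.
rewrite reM re_int im_int mul0r subr0 mulrCA.
by apply: rpredD; [apply: rpredB; [exact: dvdz_mull | exact: dvdz_mulr] |
  exact: dvdz_mulr].
Qed.

(** The contrapositive of [improvable_unit], for any of the three coordinates:
    used below to derive divisibilities from the absence of overlattices. *)
Lemma improvable_radical G a b c : posdef G -> disc G = normg delta ->
  radical G a b c -> (normg q %| value G a b c)%Z -> ~ improvable G ->
  [/\ dvdg q a, dvdg q b & dvdg q c].
Proof.
move=> pG dG [q1 q2 q3] q_v no; split; apply: NNPP => q_n; apply: no.
- apply: improvable_swap12; apply: improvable_swap23.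
  apply: (improvable_unit (a := b) (b := c) (c := a)) => //.
  + apply: posdef_swap23; exact: posdef_swap12.
  + by rewrite disc_swap23 disc_swap12.
  + split; rewrite /dot1 /dot2 /dot3 /= ?conjgK.
    * by move: q2; rewrite /dot2; congr dvdg; ring.
    * by move: q3; rewrite /dot3; congr dvdg; ring.
    * by move: q1; rewrite /dot1; congr dvdg; ring.
  suff -> : value (swap23 (swap12 G)) b c a = value G a b c by [].
  by apply: int_inj; rewrite !valueE /dot1 /dot2 /dot3 /= !conjgK; ring.
- apply: improvable_swap23.
  apply: (improvable_unit (a := a) (b := c) (c := b)) => //.
  + exact: posdef_swap23.
  + by rewrite disc_swap23.
  + split; rewrite /dot1 /dot2 /dot3 /= ?conjgK.
    * by move: q1; rewrite /dot1; congr dvdg; ring.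
    * by move: q3; rewrite /dot3; congr dvdg; ring.
    * by move: q2; rewrite /dot2; congr dvdg; ring.
  suff -> : value (swap23 G) a c b = value G a b c by [].
  by apply: int_inj; rewrite !valueE /dot1 /dot2 /dot3 /= !conjgK; ring.
- exact: (improvable_unit pG dG (And3 q1 q2 q3) q_v).
Qed.

Lemma dvd_norm_disc G : disc G = normg delta -> (normg q %| disc G)%Z.
Proof.
move=> ->; have [[t ->] _ _] := q_least.
by rewrite normgM dvdz_mulr.
Qed.

Lemma dvdg_disc G : disc G = normg delta -> dvdg q (disc G)%:~R.
Proof.
move=> dG; apply: dvdg_trans (dvdg_int (dvd_norm_disc dG)).
by exists (conjg q); rewrite mul_conjg.
Qed.

(** The last row of the adjugate matrix is orthogonal to [e1] and [e2], its
    product with [e3] is [disc G] and its value is [disc G * minor G]. *)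
Lemma cofactors_dvd G : posdef G -> disc G = normg delta -> ~ improvable G ->
  [/\ dvdg q (conjg (h12 G * h23 G) - (n2 G)%:~R * conjg (h13 G)),
      dvdg q (h12 G * conjg (h13 G) - (n1 G)%:~R * conjg (h23 G)) &
      dvdg q (minor G)%:~R].
Proof.
move=> pG dG no; set v1 := _ - _; set v2 := _ - _; set v3 : gauss := _%:~R.
have d1 : dot1 G v1 v2 v3 = 0 by rewrite /dot1 /v3 /minor; gauss_ring.
have d2 : dot2 G v1 v2 v3 = 0 by rewrite /dot2 /v3 /minor; gauss_ring.
have d3 : dot3 G v1 v2 v3 = (disc G)%:~R.
  by rewrite /dot3 /v3 /minor /disc; gauss_ring.
apply: improvable_radical (no) => //.
  split; rewrite ?d1 ?d2 ?d3; [exact: dvdg0 | exact: dvdg0 | ].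
  exact: dvdg_disc.
have -> : value G v1 v2 v3 = disc G * minor G.
  by apply: int_inj; rewrite valueE d1 d2 d3 intrM /v3; ring.
by rewrite dvdz_mulr // dvd_norm_disc.
Qed.

End Improve.

Lemma dvdg_value q G a b c :
  radical q G a b c -> dvdg q (value G a b c)%:~R.
Proof.
by case=> q1 q2 q3; rewrite valueE; do 2?apply: dvdgD; apply: dvdg_mulr.
Qed.

Section Minors.
Variables (delta q : gauss) (G : gram3).
Hypothesis q_least : least_divisor delta q.
Hypotheses (pG : posdef G) (dG : disc G = normg delta) (noG : ~ improvable G).

Let a : gauss := (n1 G)%:~R.
Let b : gauss := (n2 G)%:~R.
Let c : gauss := (n3 G)%:~R.
Let x := h12 G.
Let y := h13 G.
Let z := h23 G.

(** All entries of the adjugate matrix, obtained from its last row by permuting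
    the basis. *)
Lemma minors_dvd :
  [/\ [/\ dvdg q (a * b - x * conjg x), dvdg q (a * z - conjg x * y) &
          dvdg q (b * y - x * z)],
      [/\ dvdg q (a * conjg z - x * conjg y), dvdg q (a * c - y * conjg y) &
          dvdg q (c * x - y * conjg z)] &
      [/\ dvdg q (b * conjg y - conjg (x * z)),
          dvdg q (c * conjg x - conjg y * z) & dvdg q (b * c - z * conjg z)]].
Proof.
have [A1 A2 A3] := cofactors_dvd q_least pG dG noG.
have [||B1 B2 B3] := cofactors_dvd q_least (posdef_swap23 pG).
- by rewrite disc_swap23.
- by move/improvable_swap23.
have [||C1 C2 C3] := cofactors_dvd q_least (posdef_swap23 (posdef_swap12 pG)).
- by rewrite disc_swap23 disc_swap12.
- by move/improvable_swap23/improvable_swap12.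
rewrite /minor /= !conjgK in A1 A2 A3 B1 B2 B3 C1 C2 C3.
split; split.
- by move: A3; congr dvdg; rewrite /a /b /x; gauss_ring.
- by move/dvdgN: B2; congr dvdg; rewrite /a /z /x /y; gauss_ring.
- by move/dvdgN: C2; congr dvdg; rewrite /b /z /x /y; gauss_ring.
- by move/dvdgN: A2; congr dvdg; rewrite /a /z /x /y; gauss_ring.
- by move: B3; congr dvdg; rewrite /a /c /y; gauss_ring.
- by move/dvdgN: C1; congr dvdg; rewrite /c /z /x /y; gauss_ring.
- by move/dvdgN: A1; congr dvdg; rewrite /b /z /x /y; gauss_ring.
- by move/dvdgN: B1; congr dvdg; rewrite /c /z /x /y; gauss_ring.
by move: C3; congr dvdg; rewrite /b /c /z; gauss_ring.
Qed.

(** If all 2 x 2 minors vanish mod [q], eliminating one basis vector with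
    another one as pivot gives vectors of the radical. *)
Lemma pivot_radicals :
  [/\ radical q G b (- x) 0 , radical q G (- conjg x) a 0 &
  [/\ radical q G c 0 (- y) , radical q G (- conjg y) 0 a ,
      radical q G 0 c (- z) & radical q G 0 (- conjg z) b]].
Proof.
have [[M1 M2 M3] [M4 M5 M6] [M7 M8 M9]] := minors_dvd.
have zero e : e = 0 -> dvdg q e by move->; exact: dvdg0.
have eqd e e' : e = e' -> dvdg q e -> dvdg q e' by move->.
split; [ | |split]; split; rewrite /dot1 /dot2 /dot3 -/a -/b -/c -/x -/y -/z;
  try (by apply: zero; ring);
  [apply: eqd M1 | apply: eqd M3 | apply: eqd M1 | apply: eqd M2
  | apply: eqd M5 | apply: eqd M6 | apply: eqd M4 | apply: eqd M5
  | apply: eqd M8 | apply: eqd M9 | apply: eqd M7 | apply: eqd M9]; ring.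
Qed.

(** By [dvd_norm_int], [normg q] divides the value of every radical vector. The
    pivot vectors then show that the whole Gram matrix vanishes mod [q]; but in
    that case [e3] is in the radical. *)
Lemma primitive_divisor_absurd : ~ coprimez (re q) (im q).
Proof.
move=> cop.
have comps s t r : radical q G s t r -> [/\ dvdg q s, dvdg q t & dvdg q r].
  move=> rad; apply: (improvable_radical q_least pG dG rad) => //.
  exact: dvd_norm_int cop (dvdg_value rad).
have [/comps[qb /dvdgN qx _] /comps[/dvdgN qx' qa _]
  [/comps[qc _ /dvdgN qy] /comps[/dvdgN qy' _ _]
  /comps[_ _ /dvdgN qz] /comps[_ /dvdgN qz' _]]] := pivot_radicals.
rewrite !opprK in qx qx' qy qy' qz qz'.
have [|_ _ /dvdg_leq] := comps 0 0 1.
  by split; rewrite /dot1 /dot2 /dot3 !mul0r !add0r mul1r.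
by move=> /(_ isT); rewrite leNgt => /negP[]; apply: least_gt1 q_least.
Qed.

End Minors.

(** On the span of two radical vectors all products are multiples of [p]. An
    isotropic vector mod [p] of the form divided by [p] has a value divisible by
    [p ^ 2], the norm of [p]. *)
Lemma radical_pair (p : nat) G a b c a' b' c' : prime p ->
  radical p%:R G a b c -> radical p%:R G a' b' c' ->
  exists s t, [/\ ~ (dvdg p%:R s /\ dvdg p%:R t),
    radical p%:R G (s * a + t * a') (s * b + t * b') (s * c + t * c') &
    (normg p%:R %|
       value G (s * a + t * a') (s * b + t * b') (s * c + t * c'))%Z].
Proof.
move=> p_pr rv rw.
have [/(dvdg_intP p)[]] := (dvdg_value rv, dvdg_value rw).
rewrite re_int => /dvdzP[A defA] _ /(dvdg_intP p)[].
rewrite re_int => /dvdzP[C defC] _.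
have [[u1 v1] [u2 v2] [u3 v3]] := rv; have [w1 w2 w3] := rw.
pose B := u1 * conjg a' + u2 * conjg b' + u3 * conjg c'.
have [s [t [st0 iso]]] := hermitian_isotropic_mod A C B p_pr.
exists s, t; split=> //.
  have comb d d' : dvdg p%:R d -> dvdg p%:R d' -> dvdg p%:R (s * d + t * d').
    by move=> dd dd'; apply: dvdgD; apply: dvdg_mull.
  split; [move: (comb _ _ (ex_intro _ _ v1) w1) |
    move: (comb _ _ (ex_intro _ _ v2) w2) |
    move: (comb _ _ (ex_intro _ _ v3) w3)];
    rewrite /dot1 /dot2 /dot3; congr dvdg; ring.
rewrite value_pair defA defC v1 v2 v3 (normg_int p).
have -> : normg s * (A * p) + 2 * re (s * conjg t *
  (p%:R * u1 * conjg a' + p%:R * u2 * conjg b' + p%:R * u3 * conjg c'))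
  + normg t * (C * p)
  = p%:Z * (A * normg s + 2 * re (s * conjg t * B) + C * normg t).
  have -> : s * conjg t *
    (p%:R * u1 * conjg a' + p%:R * u2 * conjg b' + p%:R * u3 * conjg c') =
    p%:Z%:~R * (s * conjg t * B).
    by rewrite /B -pmulrn; ring.
  by rewrite [in LHS]reM re_int im_int; ring.
by rewrite expr2 dvdz_mul.
Qed.

Section RationalPrime.
Variables (delta : gauss) (p : nat) (G : gram3).
Hypothesis p_prime : prime p.
Hypothesis p_least : least_divisor delta p%:R.
Hypotheses (pG : posdef G) (dG : disc G = normg delta) (noG : ~ improvable G).

Lemma pair_dvd a b c a' b' c' :
  radical p%:R G a b c -> radical p%:R G a' b' c' ->
  exists s t, ~ (dvdg p%:R s /\ dvdg p%:R t) /\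
    [/\ dvdg p%:R (s * a + t * a'), dvdg p%:R (s * b + t * b') &
        dvdg p%:R (s * c + t * c')].
Proof.
move=> rv rw; have [s [t [st0 rad val]]] := radical_pair p_prime rv rw.
exists s, t; split=> //.
exact: (improvable_radical p_least pG dG rad val noG).
Qed.

Lemma pivot_dvd e s t : ~ (dvdg p%:R s /\ dvdg p%:R t) ->
  dvdg p%:R (s * e) -> dvdg p%:R (t * e) -> dvdg p%:R e.
Proof.
move=> st0 /(least_divisor_prime p_least)[ps|//].
by case/(least_divisor_prime p_least) => // pt; case: st0.
Qed.

Lemma dvdg_normg z : dvdg p%:R (z * conjg z) -> dvdg p%:R z.
Proof.
case/(least_divisor_prime p_least) => // -[t def_z].
by exists (conjg t); rewrite -[z]conjgK def_z; ring.
Qed.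

(** The pivot vectors come in pairs that are independent mod [p] unless the
    pivot vanishes; so all diagonal entries vanish mod [p], then all entries
    by the principal minors, and finally [e1, e2] is a pair of radical
    vectors. *)
Lemma rational_prime_absurd : False.
Proof.
have [[M1 _ _] [_ M5 _] [_ _ M9]] := minors_dvd p_least pG dG noG.
have [r1 r2 [r3 r4 r5 r6]] := pivot_radicals p_least pG dG noG.
have pa : dvdg p%:R (n1 G)%:~R.
  have [s [t [st0 [_ + +]]]] := pair_dvd r2 r4.
  by rewrite !mulr0 addr0 add0r; apply: pivot_dvd.
have pb : dvdg p%:R (n2 G)%:~R.
  have [s [t [st0 [+ _ +]]]] := pair_dvd r1 r6.
  by rewrite !mulr0 addr0 add0r; apply: pivot_dvd.
have pc : dvdg p%:R (n3 G)%:~R.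
  have [s [t [st0 [+ + _]]]] := pair_dvd r3 r5.
  by rewrite !mulr0 addr0 add0r; apply: pivot_dvd.
have off e e' z :
    dvdg p%:R e -> dvdg p%:R (e * e' - z * conjg z) -> dvdg p%:R z.
  move=> pe pm; apply: dvdg_normg.
  rewrite -[z * _](subKr (e * e')); apply: dvdgB => //; exact: dvdg_mulr.
have px := off _ _ _ pa M1; have py := off _ _ _ pa M5.
have pz := off _ _ _ pb M9.
have pconj z : dvdg p%:R z -> dvdg p%:R (conjg z).
  by case=> t ->; exists (conjg t); ring.
have col e z w s t r : dvdg p%:R e -> dvdg p%:R z -> dvdg p%:R w ->
    dvdg p%:R (s * e + t * z + r * w).
  by move=> *; do 2?apply: dvdgD; apply: dvdg_mull.
have rad s t r : radical p%:R G s t r by split; apply: col => //; apply: pconj.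
have [s [t [st0]]] := pair_dvd (rad 1 0 0) (rad 0 1 0).
by rewrite !mulr0 !mulr1 addr0 add0r => -[ps pt _]; case: st0.
Qed.

End RationalPrime.

Theorem improvable_of_norm_disc delta G :
  posdef G -> disc G = normg delta -> 1 < disc G -> improvable G.
Proof.
move=> pG dG d_gt1; apply: NNPP => noG.
rewrite dG in d_gt1; have [q q_least] := least_divisor_exists d_gt1.
have [|[p [p_pr p_least]]] := least_divisor_cases q_least.
  exact: primitive_divisor_absurd q_least pG dG noG.
exact: rational_prime_absurd p_pr p_least pG dG noG.
Qed.

(** * Reduction of unimodular ternary forms *)

(** [add12 k], [add13 k] and [add23 k] are the Gram matrices after replacing
    [e2] by [e2 + k e1], [e3] by [e3 + k e1] and [e3] by [e3 + k e2]. *)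
Definition add12 k G :=
  Gram3 (n1 G) (n2 G + 2 * re (k * h12 G) + normg k * n1 G) (n3 G)
  (h12 G + conjg k * (n1 G)%:~R) (h13 G) (h23 G + k * h13 G).
Definition add13 k G :=
  Gram3 (n1 G) (n2 G) (n3 G + 2 * re (k * h13 G) + normg k * n1 G)
  (h12 G) (h13 G + conjg k * (n1 G)%:~R) (h23 G + conjg k * conjg (h12 G)).
Definition add23 k G :=
  Gram3 (n1 G) (n2 G) (n3 G + 2 * re (k * h23 G) + normg k * n2 G)
  (h12 G) (h13 G + conjg k * h12 G) (h23 G + conjg k * (n2 G)%:~R).

Lemma realizable_add12 k G : realizable (add12 k G) -> realizable G.
Proof.
case=> u [v [w [[/= uu vv ww] [uv uw vw]]]].
have vu : ip v u = conjg (ip u v) by rewrite ip_conj.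
exists u, (v + (- k) *: u), w; split; split=> //;
  rewrite !ipE ?vu ?uu ?vv ?uv ?uw ?vw.
- gauss_ring.
- ring.
- ring.
Qed.
Lemma realizable_add13 k G : realizable (add13 k G) -> realizable G.
Proof.
case=> u [v [w [[/= uu vv ww] [uv uw vw]]]].
have wu : ip w u = conjg (ip u w) by rewrite ip_conj.
have vu : ip v u = conjg (ip u v) by rewrite ip_conj.
exists u, v, (w + (- k) *: u); split; split=> //;
  rewrite !ipE ?wu ?vu ?uu ?ww ?uv ?uw ?vw.
- gauss_ring.
- ring.
- ring.
Qed.
Lemma realizable_add23 k G : realizable (add23 k G) -> realizable G.
Proof.
case=> u [v [w [[/= uu vv ww] [uv uw vw]]]].
have wv : ip w v = conjg (ip v w) by rewrite ip_conj.
exists u, v, (w + (- k) *: v); split; split=> //;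
  rewrite !ipE ?wv ?vv ?ww ?uv ?uw ?vw.
- gauss_ring.
- ring.
- ring.
Qed.

Lemma posdef_n2 G : posdef G -> 0 < n2 G.
Proof. by case/posdef_swap12. Qed.

Lemma disc_add12 k G : disc (add12 k G) = disc G.
Proof. by case: G => *; rewrite !discE; gauss_ring. Qed.
Lemma disc_add13 k G : disc (add13 k G) = disc G.
Proof. by case: G => *; rewrite !discE; gauss_ring. Qed.
Lemma disc_add23 k G : disc (add23 k G) = disc G.
Proof. by case: G => *; rewrite !discE; gauss_ring. Qed.
Lemma minor_add12 k G : minor (add12 k G) = minor G.
Proof. by rewrite /minor /=; gauss_ring. Qed.
Lemma minor_add13 k G : minor (add13 k G) = minor G.
Proof. by []. Qed.
Lemma minor_add23 k G : minor (add23 k G) = minor G.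
Proof. by []. Qed.
Lemma cominor_add13 k G : cominor (add13 k G) = cominor G.
Proof. by rewrite /cominor /=; ring. Qed.
Lemma cominor_add23 k G :
  cominor (add23 k G) = cominor G + conjg k * (minor G)%:~R.
Proof. by rewrite /cominor /minor /=; gauss_ring. Qed.

(** All projections onto the first vector, and that of the third vector onto the
    component of the second orthogonal to the first, have coefficients of norm
    at most 1/2. *)
Definition reduced G :=
  [/\ 2 * normg (h12 G) <= n1 G ^+ 2, 2 * normg (h13 G) <= n1 G ^+ 2
    & 2 * normg (cominor G) <= minor G ^+ 2].

(** The order of the steps matters: [add23] leaves [h12] alone and [add13]
    leaves [h12] and [cominor] alone. *)
Lemma size_reduction G : posdef G -> exists G',
  [/\ n1 G' = n1 G, minor G' = minor G, disc G' = disc G,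
      realizable G' -> realizable G & reduced G'].
Proof.
case=> n1_gt0 m_gt0 _.
have [k k_le] := @round_gauss (h12 G) _ n1_gt0.
pose G1 := add12 (- conjg k) G.
have [l l_le] := @round_gauss (cominor G1) _ m_gt0.
pose G2 := add23 (- conjg l) G1.
have [m m_le] := @round_gauss (h13 G2) _ n1_gt0.
exists (add13 (- conjg m) G2); split=> //.
- by rewrite minor_add13 minor_add23 minor_add12.
- by rewrite disc_add13 disc_add23 disc_add12.
- by move/realizable_add13/realizable_add23/realizable_add12.
split.
- by rewrite [h12 _]/= rmorphN /= conjgK mulNr.
- rewrite -[h13 (add13 _ _)]/(h13 G2 + conjg (- conjg m) * (n1 G)%:~R).
  by rewrite rmorphN /= conjgK mulNr.
rewrite minor_add13 minor_add23 minor_add12 cominor_add13 cominor_add23.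
rewrite minor_add12.
by rewrite rmorphN /= conjgK mulNr.
Qed.

(** With [a = n1 G] and [D = minor G], reducedness and minimality give
    [a ^ 2 <= 2 D], and the identity of [minor_swap23] gives [D ^ 2 <= 2 a]; so
    [a <= 2]. For [a = 2] all the inequalities are equalities, the diagonal
    entries and the norms of [h12] and [h13] are 2, and the determinant is
    even. *)
Lemma reduced_min_id G : posdef G -> disc G = 1 -> reduced G ->
  n1 G <= n2 G -> minor G <= minor (swap23 G) ->
  n1 G + minor G <= n3 G + minor (swap23 G) ->
  G = Gram3 1 1 1 0 0 0.
Proof.
move=> [n1_gt0 m_gt0 _] d1 [rx ry rw] le12 lem le13.
have := minor_swap23 G; rewrite d1 mulr1.
have mE : minor G = n1 G * n2 G - normg (h12 G) by [].
have mE' : minor (swap23 G) = n1 G * n3 G - normg (h13 G) by [].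
have := normg_ge0 (h12 G); have := normg_ge0 (h13 G); have := normg_ge0 (h23 G).
have := normg_ge0 (cominor G).
set W := normg (cominor G) in rw *; set X := normg (h12 G) in mE rx *.
set Y := normg (h13 G) in mE' ry *; set Z := normg (h23 G).
set a := n1 G in n1_gt0 mE mE' rx ry le12 le13 *; set b := n2 G in mE le12 *.
set c := n3 G in mE' le13 *; set D := minor G in m_gt0 lem le13 mE rw *.
set D' := minor (swap23 G) in lem le13 mE' *.
move=> W_ge0 Z_ge0 Y_ge0 X_ge0 key.
have a_D : a ^+ 2 <= 2 * D by nia.
have D_a : D ^+ 2 <= 2 * a by nia.
have a_le2 : a <= 2.
  rewrite leNgt; apply/negP => a_gt2; nia.
have [a1|a2] : a = 1 \/ a = 2 by lia.
  have X0 : X = 0 by rewrite a1 in rx; lia.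
  have Y0 : Y = 0 by rewrite a1 in ry; lia.
  have D1 : D = 1 by rewrite a1 in D_a; nia.
  have W0 : W = 0 by rewrite D1 in rw; lia.
  have D'1 : D' = 1 by rewrite a1 D1 W0 in key; lia.
  have b1 : b = 1 by rewrite a1 X0 D1 in mE; lia.
  have c1 : c = 1 by rewrite a1 Y0 D'1 in mE'; lia.
  have x0 : h12 G = 0 by apply/eqP; rewrite -normg_eq0; apply/eqP.
  have y0 : h13 G = 0 by apply/eqP; rewrite -normg_eq0; apply/eqP.
  have z0 : h23 G = 0.
    have /eqP : cominor G = 0 by apply/eqP; rewrite -normg_eq0; apply/eqP.
    by rewrite /cominor -/a a1 x0 rmorph0 mul0r subr0 mul1r => /eqP.
  move: a1 b1 c1 x0 y0 z0; rewrite /a /b /c.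
  by case: (G) => ? ? ? ? ? ? /= -> -> -> -> -> ->.
exfalso.
have D2 : D = 2 by rewrite a2 in D_a a_D; nia.
have D'2 : D' = 2 by rewrite a2 D2 in rw key; lia.
have b2 : b = 2 by rewrite a2 D2 in rx mE le12; lia.
have X2 : X = 2 by rewrite a2 b2 D2 in mE; lia.
have c2 : c = 2 by rewrite a2 D'2 in ry mE' le13; lia.
have Y2 : Y = 2 by rewrite a2 c2 D'2 in mE'; lia.
move: d1; rewrite /disc -/a -/b -/c -/X -/Y -/Z a2 b2 c2 X2 Y2.
by lia.
Qed.

(** Descent on [n1 G + minor G]: as long as one of the three minimality
    conditions of [reduced_min_id] fails, a permutation of the basis
    decreases it. *)
Lemma unimodular_realizable G : posdef G -> disc G = 1 -> realizable G.
Proof.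
have [n] := ubnP (absz (n1 G + minor G)); elim: n G => // n IH G0 le_n pG0 dG0.
have [G [n1E mE dE rE red]] := size_reduction pG0.
apply: rE; have dG : disc G = 1 by rewrite dE.
have pG : posdef G by case: pG0 => *; split; rewrite ?n1E ?mE ?dE.
have lt_n : (`|(n1 G + minor G)%R| < n.+1)%N by rewrite n1E mE.
have [n1_gt0 m_gt0 _] := pG.
have [lt21|le12] := ltP (n2 G) (n1 G).
  apply: realizable_swap12; apply: IH; rewrite ?disc_swap12 //.
    have -> : minor (swap12 G) = minor G by rewrite /minor /=; gauss_ring.
    by have /= := posdef_n2 pG; lia.
  exact: posdef_swap12.
have [ltm|lem] := ltP (minor (swap23 G)) (minor G).
  have pG' := posdef_swap23 pG.
  apply: realizable_swap23; apply: IH; rewrite ?disc_swap23 //.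
  by have [_ ? _] := pG'; rewrite /=; lia.
(* The basis [e3, e1, e2] has the leading minor of [e1, e3]. *)
have [lt13|le13] := ltP (n3 G + minor (swap23 G)) (n1 G + minor G).
  have pG' := posdef_swap12 (posdef_swap23 pG).
  apply: realizable_swap23; apply: realizable_swap12; apply: IH => //.
    have [/= ? ? _] := pG'.
    have mE' : minor (swap12 (swap23 G)) = minor (swap23 G).
      by rewrite /minor /=; gauss_ring.
    by rewrite /= in mE' *; lia.
  by rewrite disc_swap12 disc_swap23.
rewrite (reduced_min_id pG dG red le12 lem le13).
exists (delta_mx 0 0), (delta_mx 0 1), (delta_mx 0 2%:R).
by split; split; rewrite /ip !big_ord_recl big_ord0 !mxE /=; gauss_ring.
Qed.

Theorem norm_disc_realizable delta G :
  posdef G -> disc G = normg delta -> realizable G.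
Proof.
have [n] := ubnP (absz (disc G)); elim: n G delta => // n IH G delta le_n pG dG.
have [_ _ d_gt0] := pG.
have [d1|d_neq1] := eqVneq (disc G) 1; first exact: unimodular_realizable.
have [|G' [delta' [pG' dG' lt_d]]] := improvable_of_norm_disc pG dG.
  by lia.
by apply; apply: (IH _ delta') => //; have [_ _ ?] := pG'; lia.
Qed.

(** The determinant of the orthogonal sum with [<d>], where
    [d = a * c - normg x], is [d ^ 2], the norm of [d]. *)
Theorem binary_sum_of_three_norms (a c : int) (x : gauss) :
  0 < a -> 0 < a * c - normg x ->
  exists u v, [/\ ip u u = a%:~R, ip v v = c%:~R & ip u v = x].
Proof.
move=> a_gt0 d_gt0; pose d := a * c - normg x.
pose G := Gram3 a c d x 0 0.
have dE : disc G = d ^+ 2 by rewrite discE /d; gauss_ring.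
have pG : posdef G by split=> //; rewrite dE exprn_gt0.
have [|u [v [w [[/= uu vv _] [uv _ _]]]]] :=
    @norm_disc_realizable d%:~R G pG; last by exists u, v.
by rewrite dE normg_int.
Qed.

(** * Bases of binary Hermitian lattices *)

Definition toE (z : gauss) : E := Complex (re z)%:~R (im z)%:~R.

Lemma toE_is_zmod_morphism : zmod_morphism toE.
Proof. by move=> [a b] [c d]; rewrite /toE !gaussE /= !rmorphB. Qed.
Lemma toE_is_monoid_morphism : monoid_morphism toE.
Proof.
split=> // [[a b] [c d]].
by congr Complex; rewrite !gaussE /= ?rmorphB ?rmorphD /= !rmorphM.
Qed.
HB.instance Definition _ :=
  GRing.isZmodMorphism.Build gauss E toE toE_is_zmod_morphism.
HB.instance Definition _ :=
  GRing.isMonoidMorphism.Build gauss E toE toE_is_monoid_morphism.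

Lemma toE_conj z : toE (conjg z) = conjE (toE z).
Proof. by congr Complex; rewrite /= rmorphN. Qed.

Lemma gaussIntP (z : E) : reflect (exists g, z = toE g) (z \in gaussInt).
Proof.
apply: (iffP idP) => [|[g ->]]; last by rewrite inE /= !intr_int.
case: z => a b; rewrite inE /= => /andP[/intrP[m ->] /intrP[n ->]].
by exists (Gauss m n).
Qed.

Definition sqnorm (z : E) : rat := complex.Re z ^+ 2 + complex.Im z ^+ 2.

Lemma mul_conjE (z : E) : z * conjE z = Complex (sqnorm z) 0.
Proof. by case: z => a b; congr Complex; rewrite /sqnorm /=; ring. Qed.

Lemma sqnorm_gt0 (z : E) : z != 0 -> 0 < sqnorm z.
Proof.
case: z => a b; rewrite eq_complex /= negb_and /sqnorm /= => nz.
rewrite lt_def addr_ge0 ?sqr_ge0 // andbT paddr_eq0 ?sqr_ge0 // !sqrf_eq0.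
by rewrite negb_and.
Qed.

Lemma round_rat (r : rat) : exists k : int, (r - k%:~R) ^+ 2 <= 4^-1.
Proof.
exists (Num.floor (r + 2^-1)).
have := floor_le (r + 2^-1); have := lt_succ_floor (r + 2^-1).
rewrite intrD; set k : rat := _%:~R => lt_k le_k; nra.
Qed.

Lemma round_toE (z : E) : exists g, sqnorm (z - toE g) < 1.
Proof.
have [k k_le] := round_rat (complex.Re z).
have [l l_le] := round_rat (complex.Im z).
exists (Gauss k l); case: z k_le l_le => a b /= k_le l_le.
by rewrite /sqnorm /=; lra.
Qed.

Section Span.
Variables (V : vectType E) (s : seq V).

Lemma gaussSpan_lin c u v : c \in gaussInt ->
  gaussSpan s u -> gaussSpan s v -> gaussSpan s (c *: u + v).
Proof.
move=> c_int [a [a_int ->]] [b [b_int ->]]; exists (fun i => c * a i + b i).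
split=> [i|]; first by rewrite rpredD ?rpredM.
rewrite scaler_sumr -big_split /=; apply: eq_bigr => i _.
by rewrite scalerDl scalerA.
Qed.

Lemma gaussSpan0 : gaussSpan s 0.
Proof.
exists (fun=> 0); split=> [i|]; rewrite ?rpred0 // big1 // => i _.
by rewrite scale0r.
Qed.

Lemma gaussSpan_gen v : v \in s -> gaussSpan s v.
Proof.
move=> /(nthP 0)[i lt_i <-]; exists (fun j => (j == Ordinal lt_i)%:R); split.
  by move=> j; case: (_ == _); rewrite ?rpred1 ?rpred0.
rewrite (bigD1 (Ordinal lt_i)) //= eqxx scale1r big1 ?addr0 // => j /negbTE->.
by rewrite scale0r.
Qed.

Lemma gaussSpan_span v : gaussSpan s v -> v \in <<s>>%VS.
Proof.
case=> c [_ ->]; rewrite rpred_sum // => i _.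
by rewrite rpredZ // memv_span // mem_nth.
Qed.
End Span.

Lemma gaussSpan2P (V : vectType E) (v w u : V) :
  gaussSpan [:: v; w] u <-> exists a b,
    [/\ a \in gaussInt, b \in gaussInt & u = a *: v + b *: w].
Proof.
split=> [[c [c_int ->]]|[a [b [a_int b_int ->]]]].
  exists (c ord0), (c (lift ord0 ord0)); split=> //.
  by rewrite big_ord_recl big_ord1.
exists (fun i => if i == ord0 then a else b); split.
  by move=> i; case: (_ == _).
by rewrite big_ord_recl big_ord1.
Qed.

Section Binary.
Variable L : hermLattice.
Hypothesis L_pos : lpositive L.
Notation h := (hform L).

Lemma hform_sym u v : h u v = conjE (h v u).
Proof. by rewrite hermC mul1r. Qed.

Lemma free2P (v w : hspace L) : free [:: v; w] ->
  forall a b, a *: v + b *: w = 0 -> a = 0 /\ b = 0.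
Proof.
move=> /(@freeP _ _ _ [tuple v; w]) fr a b ab0.
have := fr (fun i => if i == ord0 then a else b).
rewrite big_ord_recl big_ord1 /= => /(_ ab0) c0.
by have := c0 ord0; have := c0 (lift ord0 ord0).
Qed.

Lemma hformDl u v w : h (u + v) w = h u w + h v w.
Proof. exact: linearDl. Qed.
Lemma hformDr u v w : h w (u + v) = h w u + h w v.
Proof. exact: linearDr. Qed.
Lemma hformZl k u w : h (k *: u) w = k * h u w.
Proof. exact: linearZl_LR. Qed.
Lemma hformZr k u w : h w (k *: u) = conjE k * h w u.
Proof. exact: linearZr_LR. Qed.
Definition hformE := (hformDl, hformDr, hformZl, hformZr).

Lemma form_self_int (v : hspace L) :
  inLattice v -> exists n : int, h v v = toE n%:~R.
Proof.
move=> Lv; have /gaussIntP[g def_g] := hform_int Lv Lv.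
exists (re g); rewrite def_g; congr toE; have := hform_sym v v.
rewrite def_g -toE_conj => /(congr1 (@complex.Im _)) /= /intr_inj im_g.
by apply: gauss_eq; rewrite gaussE //; lia.
Qed.

Definition gram_det (v w : hspace L) : E := h v v * h w w - h v w * h w v.

Lemma gram_det_addl a b v w :
  gram_det (a *: v + b *: w) w = a * conjE a * gram_det v w.
Proof.
by rewrite /gram_det !hformE; ring.
Qed.

Notation lat := (@inLattice L).

Lemma lat_lin c u v : c \in gaussInt -> lat u -> lat v -> lat (c *: u + v).
Proof. exact: gaussSpan_lin. Qed.

Lemma Re_toE z : complex.Re (toE z) = (re z)%:~R. Proof. by []. Qed.

Definition free_pair v w := [/\ lat v, lat w & free [:: v; w]].

Lemma free_pairC v w : free_pair v w -> free_pair w v.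
Proof.
case=> Lv Lw fr; split=> //; rewrite (perm_free (Y := [:: v; w])) //.
by rewrite (perm_catC [:: w] [:: v]).
Qed.

Lemma free_pair_neq0 v w : free_pair v w -> v != 0.
Proof.
case=> _ _; rewrite free_cons => /andP[+ _].
by apply: contraNneq => ->; rewrite mem0v.
Qed.

(** The vector [u = <v, v> w - <w, v> v] is orthogonal to [v], and [<u, u>] is
    [<v, v>] times the determinant. *)
Lemma gram_det_gt0 v w : free_pair v w ->
  exists2 n : int, 0 < n & gram_det v w = toE n%:~R.
Proof.
move=> fp; have [Lv Lw fr] := fp.
have [a hvv] := form_self_int Lv; have [c hww] := form_self_int Lw.
have /gaussIntP[x hvw] := hform_int Lv Lw.
have hwv : h w v = toE (conjg x) by rewrite hform_sym hvw toE_conj.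
have a_gt0 : 0 < a.
  by have := L_pos Lv (free_pair_neq0 fp); rewrite hvv Re_toE re_int ltr0z.
have detE : gram_det v w = toE (a * c - normg x)%:~R.
  rewrite /gram_det hvv hww hvw hwv -!rmorphM -rmorphB /=.
  by congr toE; gauss_ring.
exists (a * c - normg x) => //.
pose u := toE a%:~R *: w + (- toE (conjg x)) *: v.
have Lu : lat u.
  apply: gaussSpan_lin => //; first by apply/gaussIntP; exists a%:~R.
  rewrite -[_ *: v]addr0; apply: gaussSpan_lin => //; last exact: gaussSpan0.
  by rewrite rpredN; apply/gaussIntP; exists (conjg x).
have u_neq0 : u != 0.
  apply/eqP; rewrite /u addrC => /(free2P fr)[_] /(congr1 (@complex.Re _)) /=.
  by rewrite re_int => /eqP; rewrite intr_eq0 gt_eqF.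
have := L_pos Lu u_neq0.
have -> : h u u = toE (a * (a * c - normg x))%:~R.
  rewrite /u !hformE hvv hww hvw hwv.
  rewrite -!rmorphN -!toE_conj -!rmorphM -!rmorphD /=.
  by congr toE; gauss_ring.
by rewrite Re_toE re_int ltr0z pmulr_rgt0.
Qed.

(** Replacing [v] by [a' v + b w], with [a'] the difference of [a] and its
    nearest Gaussian integer, multiplies the determinant by the norm of [a']. *)
Lemma free_pair_improve v w a b : free_pair v w -> lat (a *: v + b *: w) ->
  a \notin gaussInt -> exists v' w', free_pair v' w' /\
    exists2 r : rat, 0 < r < 1 & gram_det v' w' = Complex r 0 * gram_det v w.
Proof.
move=> fp; have [Lv Lw fr] := fp => Lu a_int.
have [g g_lt] := round_toE a; pose a' := a - toE g.
have a'_neq0 : a' != 0.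
  apply: contraNneq a_int => /eqP; rewrite subr_eq0 => /eqP ->.
  by apply/gaussIntP; exists g.
have a'E : a' *: v + b *: w = (- toE g) *: v + (a *: v + b *: w).
  by rewrite /a' scalerBl scaleNr addrA [- _ + _]addrC.
exists (a' *: v + b *: w), w; split; last first.
  exists (sqnorm a'); first by rewrite sqnorm_gt0.
  by rewrite gram_det_addl mul_conjE.
split=> //.
  rewrite a'E; apply: lat_lin => //; rewrite rpredN; apply/gaussIntP.
  by exists g.
rewrite free_cons seq1_free span_seq1.
move: (fr); rewrite free_cons seq1_free span_seq1 => /andP[vNw ->].
rewrite andbT.
apply: contra vNw => /vlineP[k def_k].
have : a' *: v = (k - b) *: w by rewrite [RHS]scalerBl -def_k addrK.
move=> /(congr1 (fun t => a'^-1 *: t)); rewrite !scalerA mulVf // scale1r => ->.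
by rewrite memvZ // memv_line.
Qed.

Lemma exists_free_pair : binary L -> exists v w, free_pair v w.
Proof.
rewrite /binary /lrank => rk2.
have [v v_gen v_neq0] : exists2 v, v \in hgens L & v != 0.
  apply/hasP; apply: contraT => /hasPn no; move: rk2.
  suff -> : <<hgens L>>%VS = 0%VS by rewrite dimv0.
  apply/eqP; rewrite -subv0; apply/span_subvP => u /no.
  by rewrite negbK => /eqP->; rewrite mem0v.
have [w w_gen wNv] : exists2 w, w \in hgens L & w \notin <[v]>%VS.
  apply/hasP; apply: contraT => /hasPn no.
  have /dimvS : (<<hgens L>> <= <[v]>)%VS.
    by apply/span_subvP => u /no; rewrite negbK.
  by rewrite rk2 dim_vline; case: (_ != _).
exists w, v; split; try exact: gaussSpan_gen.
by rewrite free_cons seq1_free span_seq1 wNv.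
Qed.

(** An independent pair with least determinant is a basis: otherwise some
    lattice vector has a non-integral coordinate, and [free_pair_improve]
    applies. *)
Lemma binary_basis : binary L -> exists v w, free_pair v w /\
  forall u, lat u -> gaussSpan [:: v; w] u.
Proof.
move=> bin; have [v [w fp]] := exists_free_pair bin.
have [n n_gt0 detE] := gram_det_gt0 fp.
have [m] := ubnP (absz n).
elim: m n v w fp n_gt0 detE => // m IH n v w fp n_gt0 detE le_m.
have [//|no] := classic (exists v w,
  free_pair v w /\ forall u, lat u -> gaussSpan [:: v; w] u).
have step v' w' r : free_pair v' w' -> 0 < r < 1 ->
  gram_det v' w' = Complex r 0 * gram_det v w -> False.
  move=> fp' /andP[r_gt0 r_lt1] det'.
  have [n' n'_gt0 det'E] := gram_det_gt0 fp'.
  apply: no; apply: (IH _ _ _ fp' n'_gt0 det'E).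
  have : n' < n; last by lia.
  move: det'; rewrite det'E detE => /(congr1 (@complex.Re _)) /=.
  rewrite !re_int im_int mul0r subr0 => n'E.
  by rewrite -(ltr_int rat) n'E gtr_pMl // ltr0z.
have detC v1 w1 : gram_det v1 w1 = gram_det w1 v1.
  by rewrite /gram_det mulrC [h v1 w1 * _]mulrC.
exists v, w; split=> // u Lu.
have [Lv Lw fr] := fp.
have : u \in <<[:: v; w]>>%VS.
  have /eqP -> : <<[:: v; w]>>%VS == <<hgens L>>%VS.
    rewrite eqEdim (eqP fr) [X in (X <= _)%N]bin andbT.
    apply/span_subvP => t; rewrite !inE => /orP[]/eqP->;
      exact: gaussSpan_span.
  exact: gaussSpan_span.
rewrite span_cons span_seq1.
case/memv_addP=> _ /vlineP[a ->] [_ /vlineP[b ->]] def_u.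
rewrite def_u in Lu *; apply/gaussSpan2P; exists a, b; split=> //.
  apply: contraT => a_int.
  have [v' [w' [fp' [r r01 det']]]] := free_pair_improve fp Lu a_int.
  by case: (step v' w' r).
apply: contraT => b_int; rewrite addrC in Lu.
have [v' [w' [fp' [r r01 det']]]] := free_pair_improve (free_pairC fp) Lu b_int.
by case: (step v' w' r); rewrite // det' (detC w v).
Qed.

End Binary.

(** * Universality *)

Lemma cube_lattice_positive :
  lpositive (diagLattice [tuple 1%:Z; 1%:Z; 1%:Z]).
Proof.
move=> v _ v_neq0; have [i vi_neq0] : exists i, v 0 i != 0.
  apply/existsP; apply: contraT => /existsPn no; case/eqP: v_neq0.
  by apply/rowP => i; rewrite mxE; have := no i; rewrite negbK => /eqP.
have term j : v 0 j * (tnth [tuple 1%:Z; 1%:Z; 1%:Z] j)%:~R * conjE (v 0 j)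
    = Complex (sqnorm (v 0 j)) 0.
  have -> : tnth [tuple 1%:Z; 1%:Z; 1%:Z] j = 1 by case: j => -[|[|[]]].
  by rewrite mulr1 mul_conjE.
rewrite /= /diagForm (eq_bigr _ (fun j _ => term j)).
have sq_ge0 j : 0 <= sqnorm (v 0 j) by rewrite addr_ge0 ?sqr_ge0.
have -> : \sum_(j < 3) Complex (sqnorm (v 0 j)) 0 =
    Complex (\sum_(j < 3) sqnorm (v 0 j)) 0 :> E.
  by rewrite !big_ord_recl !big_ord0 /= ; congr Complex; rewrite !addr0.
rewrite /= (bigD1 i) //= ltr_pwDl ?sqnorm_gt0 //.
exact: sumr_ge0.
Qed.

Theorem theorem2 : two_universal (diagLattice [tuple 1%:Z; 1%:Z; 1%:Z]).
Proof.
split=> [|l l_bin l_pos]; first exact: cube_lattice_positive.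
have [b1 [b2 [fp b_gen]]] := binary_basis l_pos l_bin; have [Lb1 Lb2 fr] := fp.
have [a h11] := form_self_int Lb1; have [c h22] := form_self_int Lb2.
have /gaussIntP[x h12] := hform_int Lb1 Lb2.
have h21 : hform l b2 b1 = toE (conjg x) by rewrite hform_sym h12 toE_conj.
have a_gt0 : 0 < a.
  by have := l_pos _ Lb1 (free_pair_neq0 fp); rewrite h11 Re_toE re_int ltr0z.
have d_gt0 : 0 < a * c - normg x.
  have [n n_gt0 detE] := gram_det_gt0 l_pos fp.
  suff -> : a * c - normg x = n by [].
  have : toE (a%:~R * c%:~R - x * conjg x) = toE n%:~R.
    by rewrite rmorphB !rmorphM /= -detE /gram_det h11 h22 h12 h21.
  move=> /(congr1 (@complex.Re _)) /intr_inj; rewrite re_int => <-.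
  by gauss_ring.
have [u [v [uu vv uv]]] := binary_sum_of_three_norms a_gt0 d_gt0.
exists 3, 2, (diagBasis 3), [tuple b1; b2].
split; first exact: diagLattice_basis.
split.
  split=> // t; split; first exact: b_gen.
  by move=> /gaussSpan2P[r [s [r_int s_int ->]]]; apply: lat_lin => //;
    rewrite -[s *: _]addr0; apply: lat_lin => //; apply: gaussSpan0.
pose rows (i : 'I_2) := if i == 0 then u else v.
exists (\matrix_(i, j) toE (rows i 0 j)); split.
  by apply/mxOverP => i j; rewrite mxE; apply/gaussIntP; exists (rows i 0 j).
rewrite diagLattice_gram.
have -> : diag_mx (\row_i (tnth [tuple 1%:Z; 1%:Z; 1%:Z] i)%:~R) =
    1%:M :> 'M[E]_3.
  apply/matrixP => i j; rewrite !mxE.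
  by have -> : tnth [tuple 1%:Z; 1%:Z; 1%:Z] i = 1 by case: i => -[|[|[]]].
rewrite mulmx1; apply/matrixP => i j; rewrite !mxE.
transitivity (toE (ip (rows i) (rows j))).
  have vu : ip v u = conjg x by rewrite -ip_conj uv.
  case: i => -[|[|//]] ?; case: j => -[|[|//]] ? /=;
    by rewrite ?h11 ?h22 ?h12 ?h21 ?uu ?vv ?uv ?vu.
rewrite rmorph_sum; apply: eq_bigr => k _ /=.
by rewrite rmorphM !mxE -toE_conj.
Qed.
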